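(* Let $0<\alpha<1$, let $n\in\mathbb{N}$ with $n^{1-\alpha}>2$, let $r\in\mathbb{N}$ and $f\in C_B(\mathbb{R})$. Then the following hold. (i) $$\|A_n^r(f)-f\|_\infty\le r\,\|A_n(f)-f\|_\infty\le r\left[\omega\!\left(f,\frac1{n^\alpha}\right)+\frac{2\left(q+\frac1q\right)\|f\|_\infty}{B^{\beta(n^{1-\alpha}-1)}}\right].$$ (ii) $$\|A_n^{*r}(f)-f\|_\infty\le r\,\|A_n^*(f)-f\|_\infty\le r\left[\omega\!\left(f,\frac1n+\frac1{n^\alpha}\right)+\frac{2\left(q+\frac1q\right)\|f\|_\infty}{B^{\beta(n^{1-\alpha}-1)}}\right].$$ (iii) $$\|\overline{A_n}^{\,r}(f)-f\|_\infty\le r\,\|\overline{A_n}(f)-f\|_\infty\le r\left[\omega\!\left(f,\frac1n+\frac1{n^\alpha}\right)+\frac{2\left(q+\frac1q\right)\|f\|_\infty}{B^{\beta(n^{1-\alpha}-1)}}\right].$$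
   Context: Fix real parameters $q>0$, $\beta>0$, $B>1$; $\mathbb{N}=\{1,2,3,\dots\}$. For $x\in\mathbb{R}$ and any $p>0$ put $$\nu_{p,\beta}(x)=\frac{1}{1+pB^{-\beta x}},\qquad G_{p,\beta}(x)=\tfrac12\big(\nu_{p,\beta}(x+1)-\nu_{p,\beta}(x-1)\big),\qquad \Psi(x)=\tfrac12\big(G_{q,\beta}(x)+G_{1/q,\beta}(x)\big).$$ $C_B(\mathbb{R})$ is the set of continuous bounded functions $f:\mathbb{R}\to\mathbb{R}$; $\|\cdot\|_\infty$ is the supremum norm on $\mathbb{R}$. The modulus of continuity is $\omega(f,\theta)=\sup\{|f(x)-f(y)|: x,y\in\mathbb{R},\ |x-y|\le\theta\}$ for $\theta>0$. Fix $\rho\in\mathbb{N}$ and weights $w_1,\dots,w_\rho\ge0$ with $\sum_{j=1}^\rho w_j=1$. For $n\in\mathbb{N}$ and $f\in C_B(\mathbb{R})$ define $$A_n(f)(x)=\int_{-\infty}^{\infty} f\!\left(\frac{v}{n}\right)\Psi(nx-v)\,dv,$$ $$A_n^*(f)(x)=n\int_{-\infty}^{\infty}\left(\int_{v/n}^{(v+1)/n} f(h)\,dh\right)\Psi(nx-v)\,dv,$$ $$\overline{A_n}(f)(x)=\int_{-\infty}^{\infty}\left(\sum_{j=1}^\rho w_j\, f\!\left(\frac vn+\frac{j}{n\rho}\right)\right)\Psi(nx-v)\,dv .$$ Each of these maps $C_B(\mathbb{R})$ into itself, and $A_n^r$, $A_n^{*r}$, $\overline{A_n}^{\,r}$ denote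 the $r$-fold compositions (iterates) of $A_n$, $A_n^*$, $\overline{A_n}$ with themselves. *)

(* Defs.v *)
From mathcomp Require Import all_boot all_order all_algebra.
From mathcomp Require Import all_classical all_reals all_analysis.
Set Implicit Arguments.
Unset Strict Implicit.
Unset Printing Implicit Defensive.
Import Order.TTheory GRing.Theory Num.Theory.
Import numFieldNormedType.Exports.
Local Open Scope classical_set_scope.
Local Open Scope ring_scope.

Definition CB (R : realType) : set (R -> R) :=
  [set f | continuous f /\ bounded_fun f].

(* The two suprema below are taken in the extended reals, so that they are the
   true suprema (possibly +oo) with no boundedness side condition; for f in CB
   they are finite. *)
Definition supnorm (R : realType) (f : R -> R) : \bar R :=
  ereal_sup [set `|f x|%:E | x in setT].

Definition modulus (R : realType) (f : R -> R) (theta : R) : \bar R :=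
  ereal_sup [set `|f z.1 - f z.2|%:E | z in
    [set z : R * R | `|z.1 - z.2| <= theta]].

Arguments supnorm {R} f%_R.
Arguments modulus {R} f%_R theta%_R.

Definition nu (R : realType) (B beta p x : R) : R :=
  (1 + p * B `^ (- (beta * x)))^-1.

Definition G (R : realType) (B beta p x : R) : R :=
  2^-1 * (nu B beta p (x + 1) - nu B beta p (x - 1)).

Definition Psi (R : realType) (B beta q x : R) : R :=
  2^-1 * (G B beta q x + G B beta q^-1 x).

Definition opA (R : realType) (B beta q : R) (n : nat) (f : R -> R) : R -> R :=
  fun x => \int[lebesgue_measure]_(v in setT)
    (f (v / n%:R) * Psi B beta q (n%:R * x - v)).

Definition opAstar (R : realType) (B beta q : R) (n : nat) (f : R -> R) :
    R -> R :=
  fun x => n%:R * \int[lebesgue_measure]_(v in setT)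
    ((\int[lebesgue_measure]_(h in `[v / n%:R, (v + 1) / n%:R]) f h)
     * Psi B beta q (n%:R * x - v)).

Definition opAbar (R : realType) (B beta q : R) (rho : nat) (w : nat -> R)
    (n : nat) (f : R -> R) : R -> R :=
  fun x => \int[lebesgue_measure]_(v in setT)
    ((\sum_(1 <= j < rho.+1) w j * f (v / n%:R + j%:R / (n%:R * rho%:R)))
     * Psi B beta q (n%:R * x - v)).

(* Main.v *)
(**
Each of the three operators has the form [T g (x) = E_(nx) (S g)], where [S] is
linear, replaces [g (v/n)] by an average of [g] over [[v/n, v/n + d]] ([d = 0]
or [d = 1/n]), and [E_a h] is the integral of [h v * Psi (a - v)] in [v].

The kernel is a probability density: with [c = beta ln B], the function
[ln (e^(cx) + p) / c] is a primitive of [nu_p], hence [Psi] has an explicit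
primitive, with limits 0 and 1, whose values at [-T] bound the mass of both
tails by [(q + 1/q) e^(-c(T-1))]. So [T] is a linear contraction for the sup
norm, and splitting the integral at [|nx - v| = n^(1-alpha)] bounds [T f - f].
Contraction and linearity give
[|T^(r+1) f - f| <= |T (T^r f - f)| + |T f - f|], whence the factor [r].

To iterate, [T] must preserve continuity: this follows from a Harnack inequality
[Psi x <= e^(c|x-y|) Psi y], which makes [a |-> E_a h] locally Lipschitz for
every bounded measurable [h].
*)

Require Import Defs.
From mathcomp Require Import all_boot all_order all_algebra ring lra.
From mathcomp Require Import all_classical all_reals all_analysis.
From mathcomp Require Import measurable_realfun.
Import Order.TTheory GRing.Theory Num.Theory.
Import numFieldNormedType.Exports.
Local Open Scope classical_set_scope.
Local Open Scope ring_scope.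

(** * The kernel *)

Section Logistic.
Context {R : realType} (c : R).
Hypothesis c_gt0 : 0 < c.
Implicit Types p q x T : R.

Let expDp_gt0 p x : 0 < p -> 0 < expR (c * x) + p.
Proof. by move=> p0; rewrite addr_gt0// expR_gt0. Qed.

Definition logistic p x := (1 + p * expR (- (c * x)))^-1.

Definition bump p x := 2^-1 * (logistic p (x + 1) - logistic p (x - 1)).

Definition softplus p x := ln (expR (c * x) + p) / c.

Lemma is_derive_softplus p x : 0 < p ->
  is_derive x 1 (softplus p) (logistic p x).
Proof.
move=> p0; have e0 := expDp_gt0 _ x p0.
have de : is_derive x 1 (fun y => expR (c * y) + p) (c * expR (c * x)).
  apply: is_derive_eq.
  by rewrite /GRing.scale /= !mulr1 addr0 mulrC.
have dl := is_derive1_ln e0.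
have H : is_derive x 1 (fun y => c^-1 * ln (expR (c * y) + p))
    (c^-1 * (c * expR (c * x) * (expR (c * x) + p)^-1)).
  apply: is_deriveZ.
  rewrite mulrC.
  exact: (@is_derive1_comp _ (@ln R) (fun y => expR (c * y) + p) x _ _ dl de).
have -> : softplus p = (fun y => c^-1 * ln (expR (c * y) + p)).
  by apply/funext => y; rewrite /softplus mulrC.
rewrite (_ : logistic p x =
    c^-1 * (c * expR (c * x) * (expR (c * x) + p)^-1))//.
rewrite /logistic expRN.
field.
by rewrite !gt_eqF// expR_gt0.
Qed.

(** Factor [e^(-cx) + p = p e^(-cx) (e^(cx) + 1/p)] and take logarithms. *)
Lemma softplusN p x : 0 < p ->
  softplus p (- x) = ln p / c - x + softplus p^-1 x.
Proof.
move=> p0; have e0 := @expDp_gt0 p^-1 x; rewrite invr_gt0 in e0.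
rewrite /softplus mulrN.
have -> : expR (- (c * x)) + p = p * expR (- (c * x)) * (expR (c * x) + p^-1).
  by rewrite expRN; field; rewrite !gt_eqF// expR_gt0.
rewrite !lnM ?posrE ?mulr_gt0 ?expR_gt0// ?e0// expRK.
by field; rewrite gt_eqF.
Qed.

Lemma ler_softplus p : 0 < p -> {homo softplus p : x y / x <= y}.
Proof.
move=> p0 x y xy; rewrite /softplus ler_pM2r ?invr_gt0//.
by rewrite ler_ln ?posrE ?expDp_gt0// lerD2r ler_expR ler_pM2l.
Qed.

Definition prim_bump p x := 2^-1 * (softplus p (x + 1) - softplus p (x - 1)).

Lemma is_derive_prim_bump p x : 0 < p ->
  is_derive x 1 (prim_bump p) (bump p x).
Proof.
move=> p0.
have d1 (s : R) :
    is_derive x 1 (fun y => softplus p (y + s)) (logistic p (x + s)).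
  have ds : is_derive x 1 (fun y : R => y + s) 1.
    by apply: is_derive_eq; rewrite addr0.
  have := @is_derive1_comp _ (softplus p) (fun y => y + s) x _ _
    (is_derive_softplus p (x + s) p0) ds.
  by rewrite mulr1.
rewrite /prim_bump /bump.
by apply: is_deriveZ; apply: is_deriveB.
Qed.

(** In the difference the constants [ln p / c] cancel, and the linear terms contribute
    [((x + 1) - (x - 1)) / 2 = 1]. *)
Lemma prim_bumpN p x : 0 < p -> prim_bump p (- x) = 1 - prim_bump p^-1 x.
Proof.
move=> p0; rewrite /prim_bump.
rewrite (_ : - x + 1 = - (x - 1)); last ring.
rewrite (_ : - x - 1 = - (x + 1)); last ring.
by rewrite !softplusN//; field; rewrite gt_eqF.
Qed.

Lemma prim_bump_ge0 p x : 0 < p -> 0 <= prim_bump p x.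
Proof.
move=> p0; rewrite mulr_ge0 ?invr_ge0// subr_ge0.
by apply: ler_softplus => //; lra.
Qed.

(** With [b] and [e] as set in the proof, the left side is [ln ((b + p) / (b e + p)) / (2c)]; then
    [ln (1 + y) <= y], [1 - e <= 2c] and [b e + p >= p] bound it by [b / p]. *)
Lemma prim_bump_tail p T : 0 < p ->
  prim_bump p (- T) <= p^-1 * expR (- (c * (T - 1))).
Proof.
move=> p0; rewrite /prim_bump /softplus.
rewrite (_ : c * (- T + 1) = - (c * (T - 1))); last ring.
rewrite (_ : c * (- T - 1) = - (c * (T - 1)) + - (2 * c)); last ring.
rewrite expRD; set b := expR (- (c * (T - 1))); set e := expR (- (2 * c)).
have b0 : 0 < b by exact: expR_gt0.
have e0 : 0 < e by exact: expR_gt0.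
have Z0 : 0 < b * e + p by rewrite addr_gt0// mulr_gt0.
have Y0 : 0 < b + p by rewrite addr_gt0.
have e1 : 1 - e <= 2 * c.
  by have := expR_ge1Dx (- (2 * c)); rewrite -/e; lra.
have lnYZ : ln (b + p) - ln (b * e + p) <= p^-1 * (b * (2 * c)).
  rewrite -ln_div ?posrE//.
  have -> : (b + p) / (b * e + p) = 1 + b * (1 - e) / (b * e + p).
    by field; rewrite gt_eqF.
  have le2c : b * (1 - e) / (b * e + p) <= p^-1 * (b * (2 * c)).
    rewrite ler_pdivrMr//.
    have -> : p^-1 * (b * (2 * c)) * (b * e + p) =
        p^-1 * (b * e) * (b * (2 * c)) + b * (2 * c).
      by field; rewrite gt_eqF.
    have h1 : b * (1 - e) <= b * (2 * c) by rewrite ler_pM2l.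
    have h2 : 0 <= p^-1 * (b * e) * (b * (2 * c)).
      by rewrite ltW// !mulr_gt0 ?invr_gt0.
    lra.
  apply: le_trans le2c; apply: le_ln1Dx.
  have : 0 < (b + p) / (b * e + p) by rewrite divr_gt0.
  have -> : (b + p) / (b * e + p) = 1 + b * (1 - e) / (b * e + p).
    by field; rewrite gt_eqF.
  by lra.
rewrite -mulrBl mulrA (_ : p^-1 * b = 2^-1 * (p^-1 * (b * (2 * c))) / c).
  by rewrite ler_pM2r ?invr_gt0// ler_pM2l ?invr_gt0.
by field; rewrite !gt_eqF.
Qed.

Lemma logisticN p x : 0 < p -> logistic p (- x) = 1 - logistic p^-1 x.
Proof.
move=> p0; rewrite /logistic mulrN opprK expRN.
have e0 : 0 < expR (c * x) by exact: expR_gt0.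
by field; rewrite !gt_eqF// addr_gt0// mulr_gt0.
Qed.

Lemma bumpN p x : 0 < p -> bump p (- x) = bump p^-1 x.
Proof.
move=> p0; rewrite /bump.
rewrite (_ : - x + 1 = - (x - 1)); last ring.
rewrite (_ : - x - 1 = - (x + 1)); last ring.
by rewrite !logisticN//; field.
Qed.

(** Over a common denominator the sign is visible and [x] enters only through [p e^(-cx)]; this
    serves both positivity and the Harnack inequality. *)
Lemma bumpE p x : 0 < p -> bump p x =
  2^-1 * (p * expR (- (c * x)) * (expR c - expR (- c))) /
    ((1 + p * expR (- (c * x)) * expR (- c)) *
     (1 + p * expR (- (c * x)) * expR c)).
Proof.
move=> p0; rewrite /bump /logistic.
rewrite (_ : - (c * (x + 1)) = - (c * x) + - c); last ring.
rewrite (_ : - (c * (x - 1)) = - (c * x) + c); last ring.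
rewrite !expRD !mulrA; set t := expR (- (c * x)).
have t0 : 0 < t by exact: expR_gt0.
have a0 : 1 + p * t * expR (- c) != 0.
  by rewrite gt_eqF// addr_gt0// !mulr_gt0// expR_gt0.
have b0 : 1 + p * t * expR c != 0.
  by rewrite gt_eqF// addr_gt0// !mulr_gt0// expR_gt0.
by field; rewrite a0 b0.
Qed.

Lemma bump_ge0 p x : 0 < p -> 0 <= bump p x.
Proof.
move=> p0; rewrite bumpE//.
have e0 (y : R) : 0 <= expR y by exact: expR_ge0.
have uv : 0 <= expR c - expR (- c).
  by rewrite subr_ge0 ler_expR; move: c_gt0; lra.
have t0 : 0 <= p * expR (- (c * x)) by rewrite mulr_ge0// ltW.
apply: divr_ge0; first by rewrite mulr_ge0// mulr_ge0.
by apply: mulr_ge0; rewrite addr_ge0// mulr_ge0.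
Qed.

(* [bump] is, up to a constant, [t / ((1 + t u) (1 + t v))] in [t = p e^{-cx}],
   and a translation of [x] by [s] multiplies [t] by [e^{-cs}]. *)
Lemma bump_harnack p x y : 0 < p ->
  bump p x <= expR (c * `|x - y|) * bump p y.
Proof.
move=> p0; rewrite !bumpE//.
rewrite (_ : - (c * x) = - (c * y) + c * (y - x)); last ring.
rewrite expRD; set t := expR (- (c * y)).
set u := expR (- c); set v := expR c; set l := expR (c * (y - x)).
set L := expR (c * `|x - y|).
have t0 : 0 < t by exact: expR_gt0.
have u0 : 0 < u by exact: expR_gt0.
have v0 : 0 < v by exact: expR_gt0.
have l0 : 0 < l by exact: expR_gt0.
have uv : u <= v by rewrite ler_expR; move: c_gt0; lra.
have pt0 : 0 < p * t by rewrite mulr_gt0.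
(* [L] dominates both [l] and [1 / l]. *)
have lL : l <= L by rewrite ler_expR ler_pM2l// distrC ler_norm.
have lL1 : 1 <= l * L.
  rewrite -expRD -mulrDr -expR0 ler_expR mulr_ge0 ?(ltW c_gt0)//.
  by have := ler_norm (x - y); lra.
have L1 : 1 <= L by rewrite -expR0 ler_expR mulr_ge0 ?(ltW c_gt0).
have -> : p * (t * l) = p * t * l by ring.
move: (p * t) pt0 => s s0.
have D0 (k m : R) : 0 < k -> 0 < m -> 0 < 1 + k * m.
  by move=> k0 m0; rewrite addr_gt0// mulr_gt0.
rewrite ler_pdivrMr ?mulr_gt0 ?D0 ?mulr_gt0//.
rewrite [leRHS](_ : _ = L * (2^-1 * (s * (v - u)) *
    ((1 + s * l * u) * (1 + s * l * v))) /
  ((1 + s * u) * (1 + s * v))); last ring.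
rewrite ler_pdivlMr ?mulr_gt0 ?D0//.
have -> : 2^-1 * (s * l * (v - u)) * ((1 + s * u) * (1 + s * v)) =
  2^-1 * (s * (v - u)) * (l * ((1 + s * u) * (1 + s * v))) by ring.
have -> : L * (2^-1 * (s * (v - u)) * ((1 + s * l * u) * (1 + s * l * v))) =
  2^-1 * (s * (v - u)) * (L * ((1 + s * l * u) * (1 + s * l * v))) by ring.
apply: ler_wpM2l; first by rewrite !mulr_ge0 ?invr_ge0 ?subr_ge0 ?(ltW s0).
(* The two sides are compared coefficientwise as polynomials in [s]: degree 0 needs [l <= L], degree
   1 needs [1 <= L], degree 2 needs [1 <= l L]. *)
have h1 : l * 1 <= L * 1 by rewrite !mulr1.
have a0 : 0 <= s * (u + v) by rewrite ltW// mulr_gt0// addr_gt0.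
have h2 : l * (s * (u + v)) <= L * l * (s * (u + v)).
  by apply: ler_wpM2r => //; rewrite ler_peMl// ltW.
have b0 : 0 <= l * (s * u * (s * v)) by rewrite ltW// !mulr_gt0.
have h3 : l * (s * u * (s * v)) <= l * L * (l * (s * u * (s * v))).
  by rewrite ler_peMl.
by lra.
Qed.

Lemma continuous_logistic p : 0 < p -> continuous (logistic p).
Proof.
move=> p0 x; apply: (@cvgV _ _ _ _ (fun y : R => 1 + p * expR (- (c * y)))).
  by rewrite gt_eqF// addr_gt0// mulr_gt0// expR_gt0.
apply: cvgD; first exact: cvg_cst.
apply: cvgMr; apply: continuous_cvg; first exact: continuous_expR.
by apply: cvgN; apply: cvgMr; exact: cvg_id.
Qed.

Lemma continuous_bump p : 0 < p -> continuous (bump p).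
Proof.
move=> p0.
have ls (s : R) : continuous (fun y : R => logistic p (y + s)).
  move=> x; apply: (@continuous_comp _ _ _ (fun y : R => y + s) (logistic p)).
    by apply: cvgD; [exact: cvg_id|exact: cvg_cst].
  exact: continuous_logistic.
by move=> x; apply: cvgMr; apply: cvgB; exact: ls.
Qed.

(** * The symmetrized kernel and its mass *)

Variable q : R.
Hypothesis q_gt0 : 0 < q.

Let qV_gt0 : 0 < q^-1. Proof. by rewrite invr_gt0. Qed.

Definition psi x := 2^-1 * (bump q x + bump q^-1 x).

Definition prim_psi x := 2^-1 * (prim_bump q x + prim_bump q^-1 x).

Lemma psi_ge0 x : 0 <= psi x.
Proof. by rewrite mulr_ge0// addr_ge0// bump_ge0. Qed.

(** Reflection exchanges [p] and [1/p] in [bump], so averaging over [q] and [1/q] restores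
    evenness. *)
Lemma psiN x : psi (- x) = psi x.
Proof. by rewrite /psi !bumpN// invrK addrC. Qed.

Lemma continuous_psi : continuous psi.
Proof. by move=> x; apply: cvgMr; apply: cvgD; exact: continuous_bump. Qed.

Lemma psi_harnack x y : psi x <= expR (c * `|x - y|) * psi y.
Proof.
rewrite /psi mulrCA ler_pM2l ?invr_gt0// mulrDr.
by rewrite lerD// bump_harnack.
Qed.

Lemma is_derive_prim_psi x : is_derive x 1 prim_psi (psi x).
Proof.
by apply: is_deriveZ; apply: is_deriveD; exact: is_derive_prim_bump.
Qed.

Lemma prim_psi_ge0 x : 0 <= prim_psi x.
Proof. by rewrite mulr_ge0// addr_ge0// prim_bump_ge0. Qed.

Lemma prim_psiN x : prim_psi (- x) = 1 - prim_psi x.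
Proof. by rewrite /prim_psi !prim_bumpN// invrK; field. Qed.

Lemma prim_psi_tail T :
  prim_psi (- T) <= 2^-1 * ((q + q^-1) * expR (- (c * (T - 1)))).
Proof.
rewrite /prim_psi ler_pM2l ?invr_gt0// addrC mulrDl lerD//.
  by rewrite -{2}[q]invrK prim_bump_tail.
exact: prim_bump_tail.
Qed.

Lemma cvg_prim_psi (a : R) : prim_psi (a - v) @[v --> +oo%R] --> (0 : R).
Proof.
apply: (@squeeze_cvgr _ _ _ _ (cst 0)
  (fun v => 2^-1 * ((q + q^-1) * expR (- (c * (v - a - 1)))))); last 2 first.
- exact: cvg_cst.
- rewrite -[X in _ --> X](mulr0 2^-1); apply: cvgMr.
  rewrite -[X in _ --> X](mulr0 (q + q^-1)); apply: cvgMr.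
  rewrite (_ : (fun v => _) =
    (fun v : R => expR (c * (a + 1)) * expR (- (c * v)))).
    rewrite -[X in _ --> X](mulr0 (expR (c * (a + 1)))); apply: cvgMr.
    apply: (@cvg_comp _ _ _ (fun v : R => c * v) (fun y : R => expR (- y))
      _ (pinfty_nbhs R)); last exact: cvgr_expR.
    exact: gt0_cvgMry.
  by apply/funext => v; rewrite -expRD; congr expR; ring.
- near=> v; rewrite prim_psi_ge0/=.
  by rewrite -[a - v]opprB prim_psi_tail.
Unshelve. all: by end_near. Qed.

Lemma is_derive_prim_psi_subl (a v : R) :
  is_derive v 1 (fun v => - prim_psi (a - v)) (psi (a - v)).
Proof.
have ds : is_derive v 1 (fun y : R => a - y) (-1).
  by apply: is_derive_eq; rewrite add0r mul1r.
have := @is_derive1_comp _ prim_psi (fun y => a - y) v _ _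
  (is_derive_prim_psi (a - v)) ds.
by move=> /is_deriveN; rewrite mulrN1 opprK.
Qed.

Lemma continuous_psi_subl (a : R) : continuous (fun v => psi (a - v)).
Proof.
move=> v; apply: (@continuous_comp _ _ _ (fun v : R => a - v) psi).
  by apply: cvgB; [exact: cvg_cst|exact: cvg_id].
exact: continuous_psi.
Qed.

Local Notation mu := (@lebesgue_measure R).

(** [- prim_psi (a - v)] is a primitive in [v] that tends to 0 at [+oo], so only the contribution of
    the endpoint [b] remains. *)
Lemma integral_psi_ge (a b : R) :
  (\int[mu]_(v in `[b, +oo[) (psi (a - v))%:E = (prim_psi (a - b))%:E)%E.
Proof.
have dv (v : R) := is_derive_prim_psi_subl a v.
rewrite (@ge0_continuous_FTC2y _ _ (fun v => - prim_psi (a - v)) _ 0).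
- by rewrite -EFinB sub0r opprK.
- by move=> x _; exact: psi_ge0.
- exact/continuous_subspaceT/continuous_psi_subl.
- by rewrite -oppr0; apply: cvgN; exact: cvg_prim_psi.
- by move=> x _.
- apply: cvg_at_right_filter.
  have : differentiable (fun v => - prim_psi (a - v)) b.
    by apply/derivable1_diffP; case: (dv b).
  exact: differentiable_continuous.
- by move=> x _; rewrite derive1E derive_val.
Qed.

(** The substitution [v -> -v] and the evenness of [psi] reduce this to the right tail. *)
Lemma integral_psi_le (a b : R) :
  (\int[mu]_(v in `]-oo, b]) (psi (a - v))%:E = (prim_psi (b - a))%:E)%E.
Proof.
have -> : prim_psi (b - a) = prim_psi (- a - - b) by congr prim_psi; ring.
rewrite -(integral_psi_ge (- a) (- b)) -{1}[b]opprK.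
rewrite (@ge0_integration_by_substitutionNy _ (fun v => psi (a - v)) (- b)).
- apply: eq_integral => v _; rewrite /comp.
  by rewrite -psiN; congr ((psi _)%:E); ring.
- exact/continuous_subspaceT/continuous_psi_subl.
- by move=> x _; exact: psi_ge0.
Qed.

(** Cutting at [a] gives two halves of mass [prim_psi 0], and [prim_psiN] at 0 makes their sum 1. *)
Lemma integral_psi (a : R) : (\int[mu]_v (psi (a - v))%:E = 1)%E.
Proof.
have mpsi : measurable_fun [set: R] (fun v : R => psi (a - v)).
  by apply: continuous_measurable_fun; exact: continuous_psi_subl.
have psi0 x : (0 <= (psi (a - x))%:E)%E by rewrite lee_fin psi_ge0.
rewrite -(setUv `]-oo, a]%classic) setCitvl ge0_integral_setU//=.
- rewrite integral_itv_obnd_cbnd; last exact/measurable_EFinP/measurable_funTS.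
  rewrite integral_psi_le integral_psi_ge subrr -EFinD -{2}oppr0 prim_psiN.
  by rewrite addrC subrK.
- exact/measurable_EFinP/measurable_funTS.
- by rewrite -setCitvl; apply/disj_setPS; rewrite setICr.
Qed.

Lemma integrable_psi (a : R) :
  mu.-integrable setT (EFin \o (fun v => psi (a - v))).
Proof.
have mpsi : measurable_fun [set: R] (fun v : R => psi (a - v)).
  by apply: continuous_measurable_fun; exact: continuous_psi_subl.
apply/integrableP; split; first exact/measurable_EFinP.
rewrite (_ : (\int[mu]_x _ = 1)%E) ?ltry// -(integral_psi a).
by apply: eq_integral => v _ /=; rewrite ger0_norm// psi_ge0.
Qed.

(** * Integration against the kernel *)

Definition avg (h : R -> R) (a : R) :=
  \int[mu]_(v in setT) (h v * psi (a - v)).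

Lemma integrable_avg (h : R -> R) (M a : R) : measurable_fun setT h ->
  (forall v, `|h v| <= M) ->
  mu.-integrable setT (EFin \o (fun v => h v * psi (a - v))).
Proof.
move=> mh hM.
have ipsi : mu.-integrable setT (EFin \o (fun v => M * psi (a - v))).
  have := @integrableZl _ _ R mu setT measurableT M _ (integrable_psi a).
  by apply: eq_integrable.
apply: le_integrable ipsi => //.
  apply/measurable_EFinP/measurable_funM => //.
  by apply: continuous_measurable_fun; exact: continuous_psi_subl.
move=> v _ /=; rewrite lee_fin !normrM ler_wpM2r//.
exact: le_trans (ler_norm _).
Qed.

Lemma avgB (h k : R -> R) (M N a : R) :
  measurable_fun setT h -> measurable_fun setT k ->
  (forall v, `|h v| <= M) -> (forall v, `|k v| <= N) ->
  avg (h \- k) a = avg h a - avg k a.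
Proof.
move=> mh mk hM kN; rewrite /avg -RintegralB//.
- by apply: eq_Rintegral => v _; rewrite /= mulrBl.
- exact: integrable_avg hM.
- exact: integrable_avg kN.
Qed.

(** Read from right to left, this turns a numerical bound into an integral, so that later estimates
    become pointwise comparisons of integrands. *)
Lemma avg_cst (k a : R) : avg (cst k) a = k.
Proof.
rewrite /avg RintegralZl//; last exact: integrable_psi.
by rewrite /Rintegral integral_psi mulr1.
Qed.

Lemma ler_norm_avg (h : R -> R) (M a : R) : measurable_fun setT h ->
  (forall v, `|h v| <= M) -> `|avg h a| <= M.
Proof.
move=> mh hM.
apply: le_trans (le_normr_Rintegral _ (integrable_avg _ _ a mh hM)) _ => //.
rewrite -[leRHS](avg_cst M a); apply: le_Rintegral => //.
- exact/integrable_norm/(integrable_avg _ _ a mh hM).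
- apply: (integrable_avg _ `|M|) => //; exact: measurable_cst.
- by move=> v _; rewrite normrM (ger0_norm (psi_ge0 _)) ler_wpM2r// psi_ge0.
Qed.

Lemma integrable_psi_itv (a : R) (A : set R) : measurable A ->
  mu.-integrable setT (EFin \o ((fun v => psi (a - v)) \_ A)).
Proof.
move=> mA.
rewrite -restrict_EFin; apply/(integrable_mkcond _ _).1 => //.
exact: integrableS (integrable_psi a).
Qed.

(* Off the window [|v - a| < T] the integrand is at most [2 M psi (a - v)],
   and the two tails of [psi] are controlled by [prim_psi_tail]. *)
Lemma avg_near (h : R -> R) (M k e a T : R) : measurable_fun setT h ->
  (forall v, `|h v| <= M) -> `|k| <= M -> 0 <= e ->
  (forall v, `|v - a| <= T -> `|h v - k| <= e) ->
  `|avg h a - k| <= e + 2 * M * ((q + q^-1) * expR (- (c * (T - 1)))).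
Proof.
move=> mh hM kM e0 hk.
have M0 : 0 <= M by exact: le_trans (normr_ge0 k) kM.
have mhk : measurable_fun setT (h \- cst k) by exact: measurable_funB.
have hkM v : `|(h \- cst k) v| <= 2 * M.
  rewrite /=; apply: le_trans (ler_normB _ _) _.
  by have := hM v; lra.
rewrite -{1}(avg_cst k a) -(avgB _ _ M M)//.
apply: le_trans (le_normr_Rintegral _ (integrable_avg _ _ a mhk hkM)) _ => //.
pose A := `]-oo, a - T]%classic : set R.
pose B := `[a + T, +oo[%classic : set R.
pose pA := (fun v => psi (a - v)) \_ A.
pose pB := (fun v => psi (a - v)) \_ B.
have iA : mu.-integrable setT (EFin \o pA).
  by apply: integrable_psi_itv; exact: measurable_itv.
have iB : mu.-integrable setT (EFin \o pB).
  by apply: integrable_psi_itv; exact: measurable_itv.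
(* Outside the window, [v] lies in one of the half-lines [A], [B], where the corresponding
   truncation equals the kernel. *)
have cover (v : R) : T < `|v - a| -> psi (a - v) <= pA v + pB v.
  have p0 := psi_ge0 (a - v); have [va vT|va vT] := leP v a.
    have -> : pA v = psi (a - v).
      rewrite /pA patchE mem_set// /A/= in_itv/=.
      by move: vT; rewrite ler0_norm; lra.
    by rewrite ler_wpDr// /pB patchE; case: ifP.
  have -> : pB v = psi (a - v).
    rewrite /pB patchE mem_set// /B/= in_itv/= andbT.
    by move: vT; rewrite gtr0_norm; lra.
  by rewrite ler_wpDl// /pA patchE; case: ifP.
have iZ (x : R) (g : R -> R) : mu.-integrable setT (EFin \o g) ->
    mu.-integrable setT (EFin \o (fun v => x * g v)).
  move=> /(@integrableZl _ _ R mu setT measurableT x).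
  by apply: eq_integrable.
have iD (f g : R -> R) : mu.-integrable setT (EFin \o f) ->
    mu.-integrable setT (EFin \o g) ->
    mu.-integrable setT (EFin \o (fun v => f v + g v)).
  move=> jf jg; have := @integrableD _ _ R mu setT measurableT _ _ jf jg.
  by apply: eq_integrable.
have iAB : mu.-integrable setT (EFin \o (fun v => 2 * M * (pA v + pB v))).
  exact/iZ/iD.
have ie : mu.-integrable setT (EFin \o (fun v => e * psi (a - v))).
  exact/iZ/integrable_psi.
(* One majorant for all [v]: its first summand suffices inside the window, its second outside. *)
apply: (@le_trans _ _
  (\int[mu]_(v in setT) (e * psi (a - v) + 2 * M * (pA v + pB v)))).
  apply: le_Rintegral => //.
  - exact/integrable_norm/(integrable_avg _ _ a mhk hkM).
  - exact: iD.
  - move=> v _; rewrite normrM (ger0_norm (psi_ge0 _)).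
    have p0 := psi_ge0 (a - v).
    have pA0 : 0 <= pA v by rewrite /pA patchE; case: ifP.
    have pB0 : 0 <= pB v by rewrite /pB patchE; case: ifP.
    have [vT|vT] := leP `|v - a| T.
      apply: ler_wpDr; first by rewrite !mulr_ge0// addr_ge0.
      by rewrite ler_wpM2r//; exact: hk.
    apply: ler_wpDl; first by rewrite mulr_ge0.
    apply: ler_pM => //.
    exact: cover.
rewrite RintegralD// [X in X + _](avg_cst e a) lerD2l.
rewrite RintegralZl//; last exact: iD.
rewrite ler_wpM2l ?mulr_ge0// RintegralD// -!Rintegral_mkcond /Rintegral.
rewrite integral_psi_le integral_psi_ge /=.
rewrite (_ : a - T - a = - T); last ring.
rewrite (_ : a - (a + T) = - T); last ring.
(* Each tail has mass [prim_psi (- T)]; the two together absorb the factor [1/2] of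
   [prim_psi_tail]. *)
by have := prim_psi_tail T; lra.
Qed.

(* By [psi_harnack], moving [a] to [b] changes the kernel by at most
   [(e^{c|a-b|} - 1) psi (b - v)]. *)
Lemma avg_dist (h : R -> R) (M a b : R) : measurable_fun setT h ->
  (forall v, `|h v| <= M) ->
  `|avg h a - avg h b| <= M * (expR (c * `|a - b|) - 1).
Proof.
move=> mh hM; set E := expR _.
have E1 : 1 <= E by rewrite -expR0 ler_expR mulr_ge0// ltW.
have M0 : 0 <= M by exact: le_trans (hM 0).
have psiE (v : R) : `|psi (a - v) - psi (b - v)| <= (E - 1) * psi (b - v).
  have hab := psi_harnack (a - v) (b - v).
  have hba := psi_harnack (b - v) (a - v).
  rewrite (_ : a - v - (b - v) = a - b) -/E in hab; last ring.
  rewrite (_ : b - v - (a - v) = - (a - b)) ?normrN -/E in hba; last ring.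
  (* If [psi (a - v)] is the larger value, Harnack applies directly; otherwise it yields
     [(E - 1) psi (a - v)], which is at most [(E - 1) psi (b - v)]. *)
  have [ba|/ltW ab] := leP (psi (b - v)) (psi (a - v)).
    by rewrite ger0_norm ?subr_ge0//; lra.
  rewrite ler0_norm ?subr_le0// opprB.
  have : (E - 1) * psi (a - v) <= (E - 1) * psi (b - v).
    by rewrite ler_wpM2l// subr_ge0.
  by lra.
have ia := integrable_avg h M a mh hM; have ib := integrable_avg h M b mh hM.
rewrite /avg -RintegralB//.
have iab : mu.-integrable setT
    (EFin \o (fun v => h v * psi (a - v) - h v * psi (b - v))).
  have := @integrableB _ _ R mu setT measurableT _ _ ia ib.
  by apply: eq_integrable.
apply: le_trans (le_normr_Rintegral _ iab) _ => //.
rewrite -[leRHS](avg_cst _ b); apply: le_Rintegral => //.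
- exact: integrable_norm.
- by apply: (integrable_avg _ `|M * (E - 1)|) => //; exact: measurable_cst.
- move=> v _; rewrite -mulrBr normrM /= -mulrA.
  by apply: ler_pM => //; exact: psiE.
Qed.

Lemma continuous_avg (h : R -> R) (M : R) : measurable_fun setT h ->
  (forall v, `|h v| <= M) -> continuous (avg h).
Proof.
move=> mh hM x.
apply/subr_cvg0/norm_cvg0P.
apply: (@squeeze_cvgr _ _ _ _ (cst 0)
  (fun y => M * (expR (c * `|y - x|) - 1))); last 2 first.
- exact: cvg_cst.
- have cg : continuous (fun y : R => c * `|y - x|).
    move=> y; apply: cvgMr; apply: cvg_norm.
    by apply: cvgB; [exact: cvg_id|exact: cvg_cst].
  have cE : continuous (fun y : R => M * (expR (c * `|y - x|) - 1)).
    move=> y; apply: cvgMr; apply: cvgB; last exact: cvg_cst.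
    apply: (@continuous_comp _ _ _ (fun y : R => c * `|y - x|) (@expR R)).
      exact: cg.
    exact: continuous_expR.
  have := cE x; rewrite /continuous_at subrr normr0 mulr0 expR0 subrr mulr0.
  exact.
- by near=> y; rewrite normr_ge0/=; exact: avg_dist.
Unshelve. all: by end_near. Qed.

End Logistic.

(** * Sampling operators and their iterates *)

Section Operators.
Set Implicit Arguments.
Unset Strict Implicit.
Context {R : realType}.
Implicit Types (f g : R -> R) (x M : R).

(** * Sup norm and modulus of continuity as real numbers *)

Lemma CB_bounded f : CB f -> exists M, forall x, `|f x| <= M.
Proof.
(* [bounded_fun] gives a bound by every number strictly above some [M], whence the witness
   [M + 1]. *)
by move=> [_ [M [_ fM]]]; exists (M + 1) => x; apply: fM => //; rewrite ltrDl.
Qed.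

Lemma bounded_CB f M : continuous f -> (forall x, `|f x| <= M) -> CB f.
Proof.
move=> cf fM; split => //; exists M; split; first exact: num_real.
by move=> y /ltW My x _; exact: le_trans (fM x) My.
Qed.

Lemma CBB f g : CB f -> CB g -> CB (f \- g).
Proof.
move=> Cf Cg; have [M fM] := CB_bounded Cf; have [N gN] := CB_bounded Cg.
apply: (bounded_CB (M := M + N)).
  by move=> x; apply: cvgB; [exact: Cf.1|exact: Cg.1].
by move=> x; rewrite (le_trans (ler_normB _ _))// lerD.
Qed.

Lemma supnorm_le f M : (forall x, `|f x| <= M) -> (supnorm f <= M%:E)%E.
Proof.
by move=> fM; apply: ge_ereal_sup => _ [x _ <-]; rewrite lee_fin.
Qed.

Lemma supnormP f : CB f ->
  exists2 M, supnorm f = M%:E & forall x, `|f x| <= M.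
Proof.
move=> Cf; have [M fM] := CB_bounded Cf.
have sup_ge x : (`|f x|%:E <= supnorm f)%E.
  by apply: ereal_sup_ubound; exists x.
have sup_fin : supnorm f \is a fin_num.
  rewrite fin_numE; apply/andP; split; apply/eqP => supE.
    by have := sup_ge 0; rewrite supE leeNy_eq.
  by have := supnorm_le fM; rewrite supE.
exists (fine (supnorm f)); first by rewrite fineK.
by move=> x; rewrite -lee_fin fineK.
Qed.

(** The pair [(0, 0)] is admissible as [0 <= t], which keeps the supremum above [-oo]; twice a bound
    of [f] keeps it below [+oo]. *)
Lemma modulusP f (t : R) : 0 <= t -> CB f ->
  exists m, [/\ modulus f t = m%:E, 0 <= m &
    forall x y, `|x - y| <= t -> `|f x - f y| <= m].
Proof.
move=> t0 Cf; have [M fM] := CB_bounded Cf.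
have mod_ge x y : `|x - y| <= t -> (`|f x - f y|%:E <= modulus f t)%E.
  by move=> xy; apply: ereal_sup_ubound; exists (x, y).
have mod_fin : modulus f t \is a fin_num.
  rewrite fin_numE; apply/andP; split; apply/eqP => modE.
    by have := mod_ge 0 0; rewrite modE leeNy_eq subrr normr0 => /(_ t0).
  suff : (modulus f t <= (M + M)%:E)%E by rewrite modE.
  apply: ge_ereal_sup => _ [z _ <-]; rewrite lee_fin.
  by rewrite (le_trans (ler_normB _ _))// lerD.
exists (fine (modulus f t)); split; first by rewrite fineK.
  rewrite -lee_fin fineK//; apply: le_trans (mod_ge 0 0 _).
    by rewrite lee_fin.
  by rewrite subrr normr0.
by move=> x y xy; rewrite -lee_fin fineK//; exact: mod_ge.
Qed.

(** * Operators that average samples against the kernel *)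

Section Averaging.
Variables (c q : R) (c_gt0 : 0 < c) (q_gt0 : 0 < q).
Variables (n : nat) (n_gt0 : (0 < n)%N).

(* The last clause says that [S g v] is a mean of the values of [g] on
   [[v/n, v/n + d]]; it yields both contraction ([k = 0]) and locality. *)
Definition sampling (d : R) (S : (R -> R) -> R -> R) :=
  [/\ forall g, CB g -> measurable_fun setT (S g),
      forall g h, CB g -> CB h -> S (g \- h) = S g \- S h
    & forall g v k e, CB g ->
        (forall h, v / n%:R <= h <= v / n%:R + d -> `|g h - k| <= e) ->
        `|S g v - k| <= e].

Variables (d : R) (d_ge0 : 0 <= d) (S T : (R -> R) -> R -> R).
Hypothesis S_sampling : sampling d S.
Hypothesis T_avg : forall g, CB g -> T g = fun x => avg c q (S g) (n%:R * x).

Lemma sampling_bounded g M : CB g -> (forall x, `|g x| <= M) ->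
  forall v, `|S g v| <= M.
Proof.
have [_ _ SP] := S_sampling.
move=> Cg gM v; rewrite -[S g v]subr0; apply: SP => // h _.
by rewrite subr0.
Qed.

Lemma operator_contraction g M : CB g -> (forall x, `|g x| <= M) ->
  forall x, `|T g x| <= M.
Proof.
have [mS _ _] := S_sampling.
move=> Cg gM x; rewrite T_avg//; apply: ler_norm_avg => //; first exact: mS.
exact: sampling_bounded.
Qed.

Lemma operator_CB g : CB g -> CB (T g).
Proof.
have [mS _ _] := S_sampling.
move=> Cg; have [M gM] := CB_bounded Cg.
apply: (bounded_CB (M := M)); last exact: operator_contraction.
rewrite T_avg// => x.
apply: (@continuous_comp _ _ _ (fun x : R => n%:R * x) (avg c q (S g))).
  by apply: cvgMr; exact: cvg_id.
apply: continuous_avg => //; first exact: mS.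
exact: sampling_bounded Cg gM.
Qed.

Lemma operatorB g h : CB g -> CB h -> T (g \- h) = T g \- T h.
Proof.
have [mS SB _] := S_sampling.
move=> Cg Ch; have [M gM] := CB_bounded Cg; have [N hN] := CB_bounded Ch.
apply/funext => x; rewrite !T_avg ?SB//; last exact: CBB.
rewrite (@avgB _ _ _ _ _ _ _ M N)//=; try exact: mS.
  exact: sampling_bounded Cg gM.
exact: sampling_bounded Ch hN.
Qed.

Lemma iter_operator_CB r g : CB g -> CB (iter r T g).
Proof. by move=> Cg; elim: r => //= r; exact: operator_CB. Qed.

Lemma iter_operator_dist r g M : CB g -> (forall x, `|T g x - g x| <= M) ->
  forall x, `|iter r T g x - g x| <= r%:R * M.
Proof.
move=> Cg gM; elim: r => [|r ih] x /=; first by rewrite subrr normr0 mul0r.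
have Cr := iter_operator_CB r Cg.
have := operator_contraction (CBB Cr Cg) ih x.
rewrite operatorB//= => TrM.
(* The path from [T^(r+1) g] to [g] goes through [T g]: contraction gives [r M] for the first leg,
   the hypothesis gives [M] for the second. *)
rewrite -natr1 mulrDl mul1r -[X in `|X|](subrKA (T g x)).
by rewrite (le_trans (ler_normD _ _))// lerD.
Qed.

(** The window [|v - n x| <= n^(1-alpha)] means [|v/n - x| <= n^(-alpha)], and sampling moves at
    most [d] further from [v/n]. *)
Lemma operator_dist f alpha M m : CB f -> (forall x, `|f x| <= M) -> 0 <= m ->
  (forall x y, `|x - y| <= d + 1 / n%:R `^ alpha -> `|f x - f y| <= m) ->
  forall x, `|T f x - f x| <=
    m + 2 * M * ((q + q^-1) * expR (- (c * (n%:R `^ (1 - alpha) - 1)))).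
Proof.
have [mS _ SP] := S_sampling.
have n0 : 0 < n%:R :> R by rewrite ltr0n.
move=> Cf fM m0 fm x; rewrite T_avg//; apply: avg_near => //.
- exact: mS.
- exact: sampling_bounded Cf fM.
move=> v vx; apply: SP => // h /andP[vh hv]; apply: fm.
have -> : 1 / n%:R `^ alpha = n%:R `^ (1 - alpha) / n%:R :> R.
  rewrite powRD; last by rewrite (gt_eqF n0) implybT.
  rewrite powRr1 ?ltW// powRN div1r.
  by rewrite mulrAC divff ?mul1r// gt_eqF.
have vnx : `|v / n%:R - x| <= n%:R `^ (1 - alpha) / n%:R.
  rewrite (_ : v / n%:R - x = (v - n%:R * x) / n%:R).
    by rewrite normrM [X in _ * X]gtr0_norm ?invr_gt0// ler_pM2r ?invr_gt0.
  by field; rewrite gt_eqF.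
rewrite -(subrKA (v / n%:R)) (le_trans (ler_normD _ _))// lerD//.
by rewrite ger0_norm; lra.
Qed.

(** Common form of the three claims, with [d = 0] or [d = 1/n]. Once norms and modulus are real
    numbers, both inequalities are checked pointwise. *)
Lemma iter_operator_bounds alpha r f : CB f ->
  (supnorm (iter r T f \- f) <= r%:R%:E * supnorm (T f \- f)
    <= r%:R%:E * (modulus f (d + 1 / n%:R `^ alpha)
         + (2 * (q + 1 / q))%:E * supnorm f
           / (expR (c * (n%:R `^ (1 - alpha) - 1)))%:E))%E.
Proof.
move=> Cf.
have [M fE fM] := supnormP Cf.
have CTf := CBB (operator_CB Cf) Cf.
have [D TE TD] := supnormP CTf.
have t0 : 0 <= d + 1 / n%:R `^ alpha by rewrite addr_ge0// divr_ge0// powR_ge0.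
have [m [mE m0 fm]] := modulusP t0 Cf.
rewrite TE mE fE; apply/andP; split.
  by rewrite -EFinM; apply: supnorm_le => x; exact: iter_operator_dist.
rewrite inver (gt_eqF (expR_gt0 _)) -!EFinM lee_fin ler_wpM2l//.
rewrite -lee_fin -TE; apply: supnorm_le => x.
rewrite (le_trans (operator_dist Cf fM m0 fm x))// lerD2l.
by rewrite expRN div1r !mulrA [2 * M * _]mulrAC.
Qed.

End Averaging.

(** * The three sampling maps *)

Local Notation mu := (@lebesgue_measure R).

Lemma sampling_point (n : nat) : sampling n 0 (fun g v => g (v / n%:R)).
Proof.
split => //.
- move=> g Cg; apply: continuous_measurable_fun => v.
  apply: (@continuous_comp _ _ _ (fun v : R => v / n%:R) g).
    by apply: cvgMl; exact: cvg_id.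
  exact: Cg.1.
- by move=> g v k e _; apply; rewrite addr0 lexx.
Qed.

Lemma sampling_sum (n rho : nat) (w : nat -> R) : (0 < n)%N -> (0 < rho)%N ->
  (forall j : nat, (1 <= j <= rho)%N -> 0 <= w j) ->
  \sum_(1 <= j < rho.+1) w j = 1 ->
  sampling n (1 / n%:R) (fun g v =>
    \sum_(1 <= j < rho.+1) w j * g (v / n%:R + j%:R / (n%:R * rho%:R))).
Proof.
move=> n_gt0 rho_gt0 w_ge0 w1; split.
- move=> g Cg; apply: measurable_sum => j.
  apply: measurable_funM; first exact: measurable_cst.
  apply: continuous_measurable_fun => v.
  apply: (@continuous_comp _ _ _
    (fun v : R => v / n%:R + j%:R / (n%:R * rho%:R)) g).
    by apply: cvgD; [apply: cvgMl; exact: cvg_id|exact: cvg_cst].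
  exact: Cg.1.
- move=> g h _ _; apply/funext => v; rewrite /= -sumrB.
  by apply: eq_bigr => j _; rewrite mulrBr.
- move=> g v k e _ gk.
  (* As the weights sum to 1, [k] and [e] are weighted sums of themselves, and the claim reduces to
     single terms. *)
  have sumw (y : R) : \sum_(1 <= j < rho.+1) w j * y = y.
    by rewrite -mulr_suml w1 mul1r.
  rewrite -[k]sumw -[e]sumw -sumrB.
  apply: le_trans (ler_norm_sum _ _ _) _.
  rewrite !big_nat; apply: ler_sum => j /andP[j1 jrho].
  have w0 : 0 <= w j by apply: w_ge0; rewrite j1.
  rewrite -mulrBr normrM ger0_norm// ler_wpM2l//; apply: gk.
  (* The shift [j / (n rho)] is at most [1/n] because [j <= rho]. *)
  rewrite lerDl divr_ge0// lerD2l ler_pdivrMr ?mulr_gt0 ?ltr0n//.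
  rewrite mulrA div1r mulVf ?mul1r ?ler_nat// pnatr_eq0.
  by rewrite -lt0n.
Qed.

Lemma integrable_CB_itv g (a b : R) : CB g ->
  mu.-integrable `[a, b] (EFin \o g).
Proof.
move=> Cg; apply: continuous_compact_integrable; first exact: segment_compact.
by apply: continuous_subspaceT; exact: Cg.1.
Qed.

(** Near [v] the integral is a difference of two values of one primitive of [g]. This provides the
    measurability of the sampled function. *)
Lemma continuous_window g (s t : R) : CB g -> 0 <= s -> 0 <= t ->
  continuous (fun v : R => \int[mu]_(h in `[v * s, v * s + t]) g h).
Proof.
move=> Cg s0 t0 v.
(* The base point lies strictly to the left of [v * s], so [F] is differentiable at both ends of the
   window at [v]. *)
pose F (x : R) := \int[mu]_(h in `[v * s - 1, x]) g h.
have cF (x : R) : v * s - 1 < x -> {for x, continuous F}.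
  move=> x0; have x1 : x < x + 1 by rewrite ltrDl.
  have [dF _] := @continuous_FTC1_closed R g (v * s - 1) x (x + 1) x1
    (integrable_CB_itv _ _ Cg) x0 (Cg.1 x).
  exact/differentiable_continuous/derivable1_diffP.
(* Near [v] the left end of the window stays to the right of the base point of
   the primitive [F]. *)
have near_v : \forall u \near v,
    F (u * s + t) - F (u * s) = \int[mu]_(h in `[u * s, u * s + t]) g h.
  have : \forall u \near v, v * s - 1 < u * s.
    apply: (@cvgr_gt _ _ (nbhs v) _ (fun u : R => u * s) (v * s)); last by lra.
    by apply: cvgMl; exact: cvg_id.
  apply: filterS => u us.
  rewrite /F Rintegral_itvB ?bnd_simp//; last 3 first.
  - exact: integrable_CB_itv.
  - exact: ltW.
  - by rewrite lerDl.
  apply: Rintegral_itv_obnd_cbnd.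
  apply: integrableS (integrable_CB_itv (u * s) (u * s + t) Cg) => //.
  exact: subset_itv_oc_cc.
apply: cvg_trans (near_eq_cvg near_v) _.
rewrite -(nbhs_singleton near_v).
apply: cvgB.
  apply: (@continuous_comp _ _ _ (fun v : R => v * s + t) F).
    by apply: cvgD; [apply: cvgMl; exact: cvg_id|exact: cvg_cst].
  by apply: cF; lra.
apply: (@continuous_comp _ _ _ (fun v : R => v * s) F).
  by apply: cvgMl; exact: cvg_id.
by apply: cF; lra.
Qed.

Lemma measurable_window g n : CB g -> measurable_fun setT
  (fun v : R => \int[mu]_(h in `[v / n%:R, (v + 1) / n%:R]) g h).
Proof.
move=> Cg; apply: continuous_measurable_fun.
under eq_fun do rewrite mulrDl mul1r.
by apply: continuous_window.
Qed.

Lemma sampling_window (n : nat) : (0 < n)%N -> sampling n (1 / n%:R)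
  (fun g v => n%:R * \int[mu]_(h in `[v / n%:R, (v + 1) / n%:R]) g h).
Proof.
move=> n_gt0; have n0 : 0 < n%:R :> R by rewrite ltr0n.
split.
- move=> g Cg; apply: measurable_funM; first exact: measurable_cst.
  exact: measurable_window.
- move=> g h Cg Ch; apply/funext => v /=.
  by rewrite RintegralB ?mulrBr//; exact: integrable_CB_itv.
- move=> g v k e Cg gk; set D := `[_, _]%classic.
  have mD : measurable D by exact: measurable_itv.
  have muD : fine (mu D) = n%:R^-1.
    rewrite lebesgue_measure_itv/= lte_fin ltr_pM2r ?invr_gt0// ltrDl ltr01.
    by rewrite -EFinD/= -mulrBl addrAC subrr add0r mul1r.
  have icst (y : R) : mu.-integrable D (EFin \o cst y).
    apply: continuous_compact_integrable; first exact: segment_compact.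
    by apply: continuous_subspaceT => x; exact: cvg_cst.
  (* The window has length [1/n], so [n] times the integral is a mean; [k] and [e] are rewritten as
     their own means. *)
  have avg_cst_D (y : R) : n%:R * \int[mu]_(h in D) cst y h = y.
    have -> : \int[mu]_(h in D) cst y h = y * n%:R^-1.
      by rewrite -muD; exact: Rintegral_cst.
    by rewrite mulrCA divff ?mulr1// gt_eqF.
  rewrite -[k]avg_cst_D -[e]avg_cst_D -mulrBr normrM gtr0_norm// ler_pM2l//.
  have iDg : mu.-integrable D (EFin \o g) by exact: integrable_CB_itv.
  have iDgk : mu.-integrable D (EFin \o (fun h => g h - cst k h)).
    have := @integrableB _ _ R mu D mD _ _ iDg (icst k).
    by apply: eq_integrable.
  rewrite -RintegralB//.
  apply: le_trans (le_normr_Rintegral _ iDgk) _ => //.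
  apply: le_Rintegral => //; first exact: integrable_norm.
  by move=> h; rewrite /D/= in_itv/= mulrDl => hD; exact: gk.
Qed.

End Operators.

(** * Application to the operators of the statement *)

Lemma Psi_psi {R : realType} (q beta : R) {B : R} : 1 < B ->
  Psi B beta q = psi (beta * ln B) q.
Proof.
move=> B_gt1; have B0 : 0 < B by exact: lt_trans B_gt1.
have nuE p x : nu B beta p x = logistic (beta * ln B) p x.
  by rewrite /nu /logistic /powR (gt_eqF B0); congr (1 + p * expR _)^-1; ring.
apply/funext => x; by rewrite /Psi /G !nuE.
Qed.

Theorem theorem14 (R : realType) (q beta B : R)
    (q_gt0 : 0 < q) (beta_gt0 : 0 < beta) (B_gt1 : 1 < B)
    (rho : nat) (rho_gt0 : (0 < rho)%N) (w : nat -> R)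
    (w_ge0 : forall j : nat, (1 <= j <= rho)%N -> 0 <= w j)
    (w_sum1 : \sum_(1 <= j < rho.+1) w j = 1)
    (alpha : R) (alpha_gt0 : 0 < alpha) (alpha_lt1 : alpha < 1)
    (n : nat) (n_gt0 : (0 < n)%N) (n_large : 2 < n%:R `^ (1 - alpha))
    (r : nat) (r_gt0 : (0 < r)%N)
    (f : R -> R) (f_CB : CB f) :
  [/\ (supnorm (iter r (opA B beta q n) f \- f)
         <= r%:R%:E * supnorm (opA B beta q n f \- f)
         <= r%:R%:E * (modulus f (1 / n%:R `^ alpha)
              + (2 * (q + 1 / q))%:E * supnorm f
                / (B `^ (beta * (n%:R `^ (1 - alpha) - 1)))%:E))%E,
      (supnorm (iter r (opAstar B beta q n) f \- f)
         <= r%:R%:E * supnorm (opAstar B beta q n f \- f)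
         <= r%:R%:E * (modulus f (1 / n%:R + 1 / n%:R `^ alpha)
              + (2 * (q + 1 / q))%:E * supnorm f
                / (B `^ (beta * (n%:R `^ (1 - alpha) - 1)))%:E))%E
    & (supnorm (iter r (opAbar B beta q rho w n) f \- f)
         <= r%:R%:E * supnorm (opAbar B beta q rho w n f \- f)
         <= r%:R%:E * (modulus f (1 / n%:R + 1 / n%:R `^ alpha)
              + (2 * (q + 1 / q))%:E * supnorm f
                / (B `^ (beta * (n%:R `^ (1 - alpha) - 1)))%:E))%E].

Proof.
have c_gt0 : 0 < beta * ln B by rewrite mulr_gt0// ln_gt0.
have BE x : B `^ (beta * x) = expR (beta * ln B * x).
  by rewrite /powR gt_eqF ?(lt_trans _ B_gt1)//; congr expR; ring.
(* The first modulus gets its radius in the form [0 + 1 / n^alpha], to match [d = 0]. *)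
rewrite BE -{1}[1 / _ `^ _]add0r.
have PE := Psi_psi q beta B_gt1.
have d_ge0 : 0 <= 1 / n%:R :> R by rewrite divr_ge0.
split.
- apply: (iter_operator_bounds c_gt0 q_gt0 n_gt0 _ (sampling_point n)) => //.
  by move=> g _; rewrite /opA PE.
- apply: (iter_operator_bounds c_gt0 q_gt0 n_gt0 d_ge0
    (sampling_window n_gt0)) => //.
  move=> g Cg; apply/funext => x; rewrite /opAstar PE /avg.
  have [M gM] := CB_bounded Cg.
  (* The outer factor [n] moves inside, so that the operator is an [avg] of the window means. *)
  rewrite -RintegralZl//.
    by apply: eq_Rintegral => v _; rewrite mulrA.
  (* The inner integral is bounded by [M / n], since [n] times it is a mean of [g]. *)
  apply: (integrable_avg _ c_gt0 _ q_gt0 _ (n%:R^-1 * M)).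
    exact: measurable_window.
  have n0 : 0 < n%:R :> R by rewrite ltr0n.
  move=> v; rewrite ler_pdivlMl// -{1}(gtr0_norm n0) -normrM.
  exact: (sampling_bounded (sampling_window n_gt0) Cg gM v).
- apply: (iter_operator_bounds c_gt0 q_gt0 n_gt0 d_ge0
    (sampling_sum n_gt0 rho_gt0 w_ge0 w_sum1)) => //.
  by move=> g _; rewrite /opAbar PE.
Qed.
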